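(* Let $V=g(a)$ be an $m\times n$ Vandermonde matrix, $b\in\mathbb R^m$, and let $x_\lambda=(V^\top V+\lambda^2L^\top L)^{-1}V^\top b=P(V,\lambda)V^\top b$ be the Tikhonov regularized solution of $\min_x\{\|Vx-b\|_2^2+\lambda^2\|Lx\|_2^2\}$. Let $r_\lambda=b-Vx_\lambda$ and $y=V_1^\top r_\lambda$. Assume $Mx_\lambda\ne0$ (and, for the formula for $c^{\mathsf{Reg}}_{\mathsf{VdM}}$, that every component of $Mx_\lambda$ is nonzero). Then the structured condition numbers of the Vandermonde matrix are $$m^{\mathsf{Reg}}_{\mathsf{VdM}}(V,b)=\frac{\left\|\left|MP(V,\lambda)\left[V^\top V_1\mathrm{Diag}(x_\lambda)-\mathrm{Diag}(y)\right]\right||a|+\left|MP(V,\lambda)V^\top\right||b|\right\|_\infty}{\|Mx_\lambda\|_\infty},$$ $$c^{\mathsf{Reg}}_{\mathsf{VdM}}(V,b)=\left\|\frac{\left|MP(V,\lambda)\left[V^\top V_1\mathrm{Diag}(x_\lambda)-\mathrm{Diag}(y)\right]\right||a|+\left|MP(V,\lambda)V^\top\right||b|}{Mx_\lambda}\right\|_\infty,$$ $$\kappa^{\mathsf{Reg}}_{\mathsf{VdM}}(V,b)=\frac{\left\|MP(V,\lambda)\left[\mathrm{Diag}(y)-V^\top V_1\mathrm{Diag}(x_\lambda),\ V^\top\right]\right\|_2\ \left\|\begin{bmatrix}a\\ b\end{bmatrix}\right\|_2}{\|Mx_\lambda\|_2}.$$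
   Context: Standing setting: $\lambda>0$ is fixed, $L\in\mathbb R^{p\times n}$ with $\mathrm{rank}(L)=p\le n\le m$, $\mathrm{rank}\begin{bmatrix}V\\ L\end{bmatrix}=n$, and $M\in\mathbb R^{l\times n}$ with $l\le n$. Put $P(V,\lambda)=(V^\top V+\lambda^2L^\top L)^{-1}$. For $a=[a_0,\dots,a_{n-1}]^\top\in\mathbb R^n$, $g(a)=V=[v_{ij}]$ is the $m\times n$ Vandermonde matrix with $v_{ij}=a_j^i$, $i=0,\dots,m-1$, $j=0,\dots,n-1$ (with $0^0=1$). Define $$V_1=\mathrm{Diag}(c)\begin{bmatrix}\mathbf 0\\ V(1:m-1,:)\end{bmatrix}\in\mathbb R^{m\times n},\qquad c=[0,1,\dots,m-1]^\top,$$ where $V(1:m-1,:)$ consists of the first $m-1$ rows of $V$, $\mathbf 0$ is a zero row, and $\mathrm{Diag}(d)$ is the diagonal matrix with diagonal $d$. For perturbations $\Delta a\in\mathbb R^n$, $\Delta b\in\mathbb R^m$, let $\Delta V=g(a+\Delta a)-g(a)$ and $$\Delta x=\left[(V+\Delta V)^\top(V+\Delta V)+\lambda^2L^\top L\right]^{-1}(V+\Delta V)^\top(b+\Delta b)-x_\lambda .$$ The structured condition numbers are defined by $$m^{\mathsf{Reg}}_{\mathsf{VdM}}(V,b)=\lim_{\epsilon\to0}\ \sup_{|\Delta a|\le\epsilon|a|,\ |\Delta b|\le\epsilon|b|}\frac{\|M\Delta x\|_\infty}{\epsilon\|Mx_\lambda\|_\infty},\qquad c^{\mathsf{Reg}}_{\mathsf{VdM}}(V,b)=\lim_{\epsilon\to0}\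 \sup_{|\Delta a|\le\epsilon|a|,\ |\Delta b|\le\epsilon|b|}\frac1\epsilon\left\|\frac{M\Delta x}{Mx_\lambda}\right\|_\infty,$$ $$\kappa^{\mathsf{Reg}}_{\mathsf{VdM}}(V,b)=\lim_{\epsilon\to0}\ \sup_{\|[\Delta a;\Delta b]\|_2\le\epsilon\|[a;b]\|_2}\frac{\|M\Delta x\|_2}{\epsilon\|Mx_\lambda\|_2},$$ with $\epsilon\to0$ through positive values. Here $|\cdot|$ and $\le$ on vectors and matrices are entrywise, the quotient of two vectors is componentwise, $[x;y]$ stacks $x$ on top of $y$, and $\|\cdot\|_2$ of a matrix is the spectral norm. *)

(* Defs.v *)
From HB Require Import structures.
From mathcomp Require Import all_boot all_order all_algebra.
From mathcomp Require Import all_classical all_reals all_analysis.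

Set Implicit Arguments.
Unset Strict Implicit.
Unset Printing Implicit Defensive.

Import Order.TTheory GRing.Theory Num.Theory.
Import numFieldNormedType.Exports.

Local Open Scope classical_set_scope.
Local Open Scope ring_scope.

(* Vectors of R^n are column vectors. *)

(* The library norm on matrices is the largest absolute value of an entry. On
   column vectors this is the infinity norm; on general matrices it is not the
   operator norm, hence the restriction to 'cV. *)
Definition norm_inf (R : realType) (n : nat) (v : 'cV[R]_n) : R := `|v|.

Definition norm2 (R : realType) (n : nat) (v : 'cV[R]_n) : R :=
  Num.sqrt (\sum_i v i 0 ^+ 2).

(* Largest singular value: the square root of the largest eigenvalue of A^T A.
   The set of eigenvalues is finite, and nonempty when n > 0, so that the
   supremum is then a maximum; for n = 0 it is sup set0 = 0. *)
Definition spectral_norm (R : realType) (m n : nat) (A : 'M[R]_(m, n)) : R :=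
  Num.sqrt (sup [set t : R | eigenvalue (A^T *m A) t]).

Definition absmx (R : realType) (m n : nat) (A : 'M[R]_(m, n)) : 'M[R]_(m, n) :=
  map_mx (fun t => `|t|) A.

Definition lev (R : realType) (n : nat) (u v : 'cV[R]_n) : Prop :=
  forall i, u i 0 <= v i 0.

(* Componentwise quotient; only meaningful when v has no zero component. *)
Definition divv (R : realType) (n : nat) (u v : 'cV[R]_n) : 'cV[R]_n :=
  \col_i (u i 0 / v i 0).

Definition Diag (R : realType) (n : nat) (d : 'cV[R]_n) : 'M[R]_n :=
  diag_mx d^T.

(* invmx is the true inverse only on invertible matrices. The matrix below is
   invertible when lam > 0 and V stacked on L has full column rank, a condition
   which is stable under small perturbations of V. *)
Definition tikP (R : realType) (m n p : nat) (lam : R) (L : 'M[R]_(p, n))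
    (V : 'M[R]_(m, n)) : 'M[R]_n :=
  invmx (V^T *m V + lam ^+ 2 *: (L^T *m L)).

Definition tik_sol (R : realType) (m n p : nat) (lam : R) (L : 'M[R]_(p, n))
    (V : 'M[R]_(m, n)) (b : 'cV[R]_m) : 'cV[R]_n :=
  tikP lam L V *m V^T *m b.

Definition vdm (R : realType) (m n : nat) (a : 'cV[R]_n) : 'M[R]_(m, n) :=
  Vandermonde m a^T.

(* A zero row on top of the first m - 1 rows of V; ord_pred is the cyclic
   predecessor, used here only at i > 0, where it is i - 1. *)
Definition shift_down (R : realType) (m n : nat) (V : 'M[R]_(m, n)) :
    'M[R]_(m, n) :=
  \matrix_(i, j) (if (i : nat) == 0%N then 0 else V (ord_pred i) j).

Definition vdm1 (R : realType) (m n : nat) (V : 'M[R]_(m, n)) : 'M[R]_(m, n) :=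
  Diag (\col_(i < m) (i : nat)%:R) *m shift_down V.

Definition tik_dx (R : realType) (m n p : nat) (lam : R) (L : 'M[R]_(p, n))
    (a : 'cV[R]_n) (b : 'cV[R]_m) (da : 'cV[R]_n) (db : 'cV[R]_m) :
    'cV[R]_n :=
  let V := vdm m a in
  let dV := vdm m (a + da) - vdm m a in
  tik_sol lam L (V + dV) (b + db) - tik_sol lam L V b.

Definition componentwise_ball (R : realType) (m n : nat)
    (a : 'cV[R]_n) (b : 'cV[R]_m) (e : R) : set ('cV[R]_n * 'cV[R]_m) :=
  [set d | lev (absmx d.1) (e *: absmx a) /\ lev (absmx d.2) (e *: absmx b)].

Definition normwise_ball (R : realType) (m n : nat)
    (a : 'cV[R]_n) (b : 'cV[R]_m) (e : R) : set ('cV[R]_n * 'cV[R]_m) :=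
  [set d | norm2 (col_mx d.1 d.2) <= e * norm2 (col_mx a b)].

(* The suprema are extended-real, so that they make sense even if they are
   infinite for large e. *)
Definition mixed_sup (R : realType) (m n p l : nat) (lam : R)
    (L : 'M[R]_(p, n)) (M : 'M[R]_(l, n)) (a : 'cV[R]_n) (b : 'cV[R]_m)
    (e : R) : \bar R :=
  ereal_sup
    [set (norm_inf (M *m tik_dx lam L a b d.1 d.2) /
          (e * norm_inf (M *m tik_sol lam L (vdm m a) b)))%:E
    | d in componentwise_ball a b e].

Definition componentwise_sup (R : realType) (m n p l : nat) (lam : R)
    (L : 'M[R]_(p, n)) (M : 'M[R]_(l, n)) (a : 'cV[R]_n) (b : 'cV[R]_m)
    (e : R) : \bar R :=
  ereal_sup
    [set (e^-1 * norm_inf (divv (M *m tik_dx lam L a b d.1 d.2)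
                                (M *m tik_sol lam L (vdm m a) b)))%:E
    | d in componentwise_ball a b e].

Definition normwise_sup (R : realType) (m n p l : nat) (lam : R)
    (L : 'M[R]_(p, n)) (M : 'M[R]_(l, n)) (a : 'cV[R]_n) (b : 'cV[R]_m)
    (e : R) : \bar R :=
  ereal_sup
    [set (norm2 (M *m tik_dx lam L a b d.1 d.2) /
          (e * norm2 (M *m tik_sol lam L (vdm m a) b)))%:E
    | d in normwise_ball a b e].

(* lim is total; a statement about one of these condition numbers should also
   assert that the limit exists. *)
Definition mixed_cond (R : realType) (m n p l : nat) (lam : R)
    (L : 'M[R]_(p, n)) (M : 'M[R]_(l, n)) (a : 'cV[R]_n) (b : 'cV[R]_m) :
    \bar R :=
  lim (mixed_sup lam L M a b e @[e --> 0^'+]).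

Definition componentwise_cond (R : realType) (m n p l : nat) (lam : R)
    (L : 'M[R]_(p, n)) (M : 'M[R]_(l, n)) (a : 'cV[R]_n) (b : 'cV[R]_m) :
    \bar R :=
  lim (componentwise_sup lam L M a b e @[e --> 0^'+]).

Definition normwise_cond (R : realType) (m n p l : nat) (lam : R)
    (L : 'M[R]_(p, n)) (M : 'M[R]_(l, n)) (a : 'cV[R]_n) (b : 'cV[R]_m) :
    \bar R :=
  lim (normwise_sup lam L M a b e @[e --> 0^'+]).

(* Main.v *)
Require Import Defs.
From mathcomp Require Import all_boot all_order all_algebra.
From mathcomp Require Import all_classical all_reals all_analysis.
From mathcomp Require Import ring lra.

Import Order.TTheory GRing.Theory Num.Theory.
Import numFieldNormedType.Exports.

Local Open Scope classical_set_scope.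
Local Open Scope ring_scope.

(** The map from [(a, b)] to [M *m x] is differentiable, and each condition
    number is the maximum, over the corresponding unit ball of relative
    perturbations, of a seminorm of its differential.

    Differential. Let [H] and [H'] be the normal matrices before and after the
    perturbation, [dV] the change of [V], and [r] the residual. Subtracting the
    normal equations gives ([tik_sol_difference])

      H dx = dV^T r + (V + dV)^T (db - dV x) - (H' - H) dx.

    For small perturbations [H^-1 (H' - H)] is a contraction, so that [H'] is
    invertible and [dx] is of first order; hence
    [dx = P (dV^T r + V^T (db - dV x))] up to second order
    ([tik_sol_expansion]). The normal matrix [H] itself is invertible because
    [V] stacked on [L] has full column rank. For Vandermonde matrices,
    [dV = V1 Diag(da)] up to second order ([vanishes_vdm]), and
    [Diag(u) v = Diag(v) u] turns the expansion into

      M dx = M P (Diag(y) - V^T V1 Diag(x)) da + M P V^T db + O(|(da, db)|^2)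

    ([tik_dx_expansion]).

    Passage to the limit. Both families of balls consist of the dilations of a
    bounded set, so the quotient supremum for [e] differs from the maximum of
    the linear part over the ball of radius one by [O(e)]
    ([cvg_sup_expansion]).

    Maxima. On the componentwise ball, row [i] of [G da + K db] is at most row
    [i] of [|G| |a| + |K| |b|], with equality for suitable signs
    ([componentwise_ball_max]). On the normwise ball the maximum is the
    operator norm times the radius, and the operator norm is the spectral norm:
    a maximizer of [|A c|] on the unit sphere is an eigenvector of [A^T A] for
    its largest eigenvalue ([norm2_mulmx_max_eigen], [spectral_normP]). *)

Set Implicit Arguments.
Unset Strict Implicit.
Unset Printing Implicit Defensive.

(** * The maximum norm of matrices *)

Lemma ler_mx_entry (R : realType) (m n : nat) (A : 'M[R]_(m, n)) i j :
  `|A i j| <= `|A|.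
Proof.
rewrite [leRHS]mx_normrE.
exact: (le_bigmax _ (fun ij => `|A ij.1 ij.2|) (i, j)).
Qed.

Lemma mx_norm_le (R : realType) (m n : nat) (A : 'M[R]_(m, n)) (c : R) :
  0 <= c -> (forall i j, `|A i j| <= c) -> `|A| <= c.
Proof.
move=> c0 Ac; rewrite [leLHS]mx_normrE.
by apply/bigmax_le => // ij _; exact: Ac.
Qed.

Lemma natr_mul_sum (R : realType) (k : nat) (c : R) :
  k%:R * c = \sum_(s < k) c.
Proof. by rewrite sumr_const card_ord mulr_natl. Qed.

Lemma mx_norm_mulmx (R : realType) (m k n : nat)
    (A : 'M[R]_(m, k)) (B : 'M[R]_(k, n)) :
  `|A *m B| <= k%:R * (`|A| * `|B|).
Proof.
apply: mx_norm_le => [|i j]; first by rewrite mulr_ge0 // mulr_ge0.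
rewrite mxE; apply: le_trans (ler_norm_sum _ _ _) _.
rewrite natr_mul_sum; apply: ler_sum => s _.
by rewrite normrM ler_pM ?ler_mx_entry.
Qed.

Lemma mx_norm_tr (R : realType) (m n : nat) (A : 'M[R]_(m, n)) :
  `|A^T| <= `|A|.
Proof.
by apply: mx_norm_le => // i j; rewrite mxE ler_mx_entry.
Qed.

(** * Orders of vanishing at the origin *)

(** [vanishes k f] : on the closed unit ball of [X], [f d] is bounded by a
    constant times the [k]-th power of the norm of [d]. The unit ball, rather
    than some unspecified neighbourhood of the origin, is enough for functions
    that are polynomial in the entries of [d]. *)
Definition vanishes (R : realType) (X : normedModType R)
    (W : normedZmodType R) (k : nat) (f : X -> W) : Prop :=
  exists C : R, forall d, `|d| <= 1 -> `|f d| <= C * `|d| ^+ k.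

Section Vanishes.
Variables (R : realType) (X : normedModType R).
Implicit Types (W : normedZmodType R).

Lemma vanishes_nneg W k (f : X -> W) : vanishes k f ->
  exists2 C : R, 0 <= C & forall d, `|d| <= 1 -> `|f d| <= C * `|d| ^+ k.
Proof.
move=> [C fC]; exists `|C| => // d d1; apply: le_trans (fC d d1) _.
by rewrite ler_wpM2r ?ler_norm // exprn_ge0.
Qed.

Lemma vanishes_le W j k (f : X -> W) :
  (k <= j)%N -> vanishes j f -> vanishes k f.
Proof.
move=> kj /vanishes_nneg[C C0 fC]; exists C => d d1.
apply: le_trans (fC d d1) _; rewrite ler_wpM2l //.
by apply: ler_wiXn2l.
Qed.

Lemma vanishes_cst W (w : W) : vanishes 0 (fun _ : X => w).
Proof. by exists `|w| => d _; rewrite expr0 mulr1. Qed.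

Lemma vanishesD W k (f g : X -> W) :
  vanishes k f -> vanishes k g -> vanishes k (fun d => f d + g d).
Proof.
move=> [C fC] [D gD]; exists (C + D) => d d1.
apply: le_trans (ler_normD _ _) _.
by rewrite mulrDl lerD ?fC ?gD.
Qed.

Lemma vanishesN W k (f : X -> W) :
  vanishes k f -> vanishes k (fun d => - f d).
Proof. by move=> [C fC]; exists C => d d1; rewrite normrN fC. Qed.

Lemma vanishesB W k (f g : X -> W) :
  vanishes k f -> vanishes k g -> vanishes k (fun d => f d - g d).
Proof. by move=> fk gk; apply: vanishesD => //; exact: vanishesN. Qed.

Lemma vanishesM j k (f g : X -> R) :
  vanishes j f -> vanishes k g -> vanishes (j + k) (fun d => f d * g d).
Proof.
move=> [C fC] [D gD]; exists (C * D) => d d1.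
by rewrite normrM exprD mulrACA ler_pM ?fC ?gD.
Qed.

Lemma vanishes_mulmx p q r j k (f : X -> 'M[R]_(p, q))
    (g : X -> 'M[R]_(q, r)) :
  vanishes j f -> vanishes k g -> vanishes (j + k) (fun d => f d *m g d).
Proof.
move=> [C fC] [D gD]; exists (q%:R * (C * D)) => d d1.
apply: le_trans (mx_norm_mulmx _ _) _.
by rewrite -mulrA ler_wpM2l // exprD mulrACA ler_pM ?fC ?gD.
Qed.

Lemma vanishes_tr p q k (f : X -> 'M[R]_(p, q)) :
  vanishes k f -> vanishes k (fun d => (f d)^T).
Proof.
by move=> [C fC]; exists C => d d1; exact: le_trans (mx_norm_tr _) (fC _ d1).
Qed.

Lemma vanishes_entries p q k (f : X -> 'M[R]_(p, q)) :
  (forall i j, vanishes k (fun d => f d i j)) -> vanishes k f.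
Proof.
move=> fk; have /choice[C fC] : forall ij : 'I_p * 'I_q, exists C : R, 0 <= C /\
    forall d, `|d| <= 1 -> `|f d ij.1 ij.2| <= C * `|d| ^+ k.
  by move=> ij; have [C] := vanishes_nneg (fk ij.1 ij.2); exists C.
exists (\sum_ij C ij) => d d1; apply: mx_norm_le => [|i j].
  rewrite mulr_ge0 ?exprn_ge0 // sumr_ge0 // => ij _.
  by have [] := fC ij.
have [C0 /(_ d d1) le_fC] := fC (i, j).
apply: le_trans le_fC _; rewrite ler_wpM2r ?exprn_ge0 //.
rewrite (bigD1 (i, j)) //= lerDl sumr_ge0 // => ij _.
by have [] := fC ij.
Qed.

End Vanishes.
(** * Suprema over shrinking balls *)

(** If [F] agrees with the homogeneous map [A] up to second order at the origin
    and the sets [B e] are the dilations of a bounded set [B 1], then the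
    supremum of [N (F d) / e] over [B e] tends to the maximum of [N (A d)] over
    [B 1], for every seminorm [N]. *)
Lemma cvg_sup_expansion (R : realType) (X Y : normedModType R) (F A : X -> Y)
    (N : Y -> R) (B : R -> set X) (s rho K C delta : R) :
    (forall u v, N (u + v) <= N u + N v) ->
    (forall e u, 0 < e -> N (e *: u) = e * N u) ->
    (forall u, N u <= K * `|u|) ->
    (forall e d, A (e *: d) = e *: A d) ->
    (forall e d, 0 < e -> B e (e *: d) <-> B 1 d) ->
    (forall d, B 1 d -> `|d| <= rho) ->
    0 < delta ->
    (forall d, `|d| <= delta -> `|F d - A d| <= C * `|d| ^+ 2) ->
    (forall d, B 1 d -> N (A d) <= s) ->
    (exists2 d, B 1 d & N (A d) = s) ->
  ereal_sup [set (N (F d) / e)%:E | d in B e] @[e --> 0^'+] --> s%:E.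
Proof.
move=> ND NZ NK AZ BZ Brho delta0 FA le_s [d0 Bd0 Ad0].
have rho0 : 0 <= rho by apply: le_trans (Brho _ Bd0).
(* On [B e], [N] of the remainder is at most [D * e ^+ 2]. *)
pose D := `|K| * (`|C| * rho ^+ 2).
have NFA e d : 0 < e -> e * rho <= delta -> B 1 d ->
    N (F (e *: d) - A (e *: d)) <= D * e ^+ 2 /\
    N (A (e *: d) - F (e *: d)) <= D * e ^+ 2.
  move=> e0 e_delta Bd.
  have ed : `|e *: d| <= e * rho.
    by rewrite normrZ gtr0_norm // ler_pM2l // Brho.
  have le_D : `|K| * `|F (e *: d) - A (e *: d)| <= D * e ^+ 2.
    have -> : D * e ^+ 2 = `|K| * (`|C| * (e * rho) ^+ 2) by rewrite /D; ring.
    rewrite ler_wpM2l //.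
    apply: le_trans (FA _ (le_trans ed e_delta)) _.
    apply: (@le_trans _ _ (`|C| * `|e *: d| ^+ 2)).
      by rewrite ler_wpM2r ?exprn_ge0 // ler_norm.
    rewrite ler_wpM2l // lerXn2r // nnegrE //.
    exact: le_trans ed.
  split; apply: le_trans (NK _) _; apply: le_trans le_D.
    by rewrite ler_wpM2r ?ler_norm.
  by rewrite distrC ler_wpM2r ?ler_norm.
have lin (c : R) : (s + c * e)%:E @[e --> 0^'+] --> s%:E.
  apply/fine_cvgP; split; first exact: nearW.
  apply: cvg_at_right_filter.
  rewrite -[X in _ --> X]addr0; apply: cvgD; first exact: cvg_cst.
  by rewrite -[X in _ --> X](mulr0 c); apply: cvgM;
    [exact: cvg_cst|exact: cvg_id].
apply: (@squeeze_cvge _ _ _ _ (fun e => (s + - D * e)%:E) _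
          (fun e => (s + D * e)%:E)); [|exact: lin|exact: lin].
have small : \forall e \near 0^'+, e * rho <= delta.
  near=> e; apply: (@le_trans _ _ (e * (rho + 1))).
    by rewrite ler_pM2l // lerDl.
  rewrite -ler_pdivlMr ?ltr_wpDl //.
  by near: e; apply: nbhs_right_le; rewrite divr_gt0 // ltr_wpDl.
near=> e.
have e0 : 0 < e by [].
have e_delta : e * rho <= delta by near: e.
apply/andP; split.
  (* The dilated maximizer [e *: d0] gives the lower bound. *)
  apply: (@le_trans _ _ (N (F (e *: d0)) / e)%:E); last first.
    apply: ereal_sup_ubound; exists (e *: d0) => //.
    by apply/BZ.
  rewrite lee_fin ler_pdivlMr // mulrDl -{1}Ad0 mulrC -NZ // -AZ mulNr mulNr.
  rewrite -mulrA -expr2 lerBlDr.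
  have [_ ?] := NFA e d0 e0 e_delta Bd0.
  have := ND (F (e *: d0)) (A (e *: d0) - F (e *: d0)).
  by rewrite addrC subrK => /le_trans; apply; rewrite lerD2l.
apply: ub_ereal_sup => _ [d Bd <-].
have [d' Ed Bd'] : exists2 d', d = e *: d' & B 1 d'.
  exists (e^-1 *: d); first by rewrite scalerA divff ?scale1r ?gt_eqF.
  by apply/(BZ e) => //; rewrite scalerA divff ?scale1r ?gt_eqF.
rewrite lee_fin ler_pdivrMr // mulrDl Ed.
have [? _] := NFA e d' e0 e_delta Bd'.
have := ND (A (e *: d')) (F (e *: d') - A (e *: d')).
rewrite addrC subrK => /le_trans; apply; rewrite -mulrA -expr2 lerD //.
by rewrite AZ NZ // [s * e]mulrC ler_pM2l // le_s.
Unshelve. all: by end_near. Qed.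

(** * The Euclidean norm and the spectral norm *)

Section Norm2.
Variable R : realType.

Lemma norm2_ge0 n (v : 'cV[R]_n) : 0 <= norm2 v.
Proof. exact: sqrtr_ge0. Qed.

Lemma norm2_sqr n (v : 'cV[R]_n) : norm2 v ^+ 2 = \sum_i v i 0 ^+ 2.
Proof. by rewrite sqr_sqrtr // sumr_ge0 // => i _; rewrite sqr_ge0. Qed.

Lemma norm2_sqr_mx n (v : 'cV[R]_n) : norm2 v ^+ 2 = (v^T *m v) 0 0.
Proof. by rewrite norm2_sqr mxE; apply: eq_bigr => i _; rewrite mxE expr2. Qed.

Lemma norm2Z n e (v : 'cV[R]_n) : norm2 (e *: v) = `|e| * norm2 v.
Proof.
rewrite /norm2 -sqrtr_sqr -sqrtrM ?sqr_ge0 // mulr_sumr.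
by congr Num.sqrt; apply: eq_bigr => i _; rewrite mxE exprMn.
Qed.

Lemma norm20 n : norm2 (0 : 'cV[R]_n) = 0.
Proof. by rewrite -(scale0r (0 : 'cV[R]_n)) norm2Z normr0 mul0r. Qed.

Lemma ler_norm2_entry n (v : 'cV[R]_n) i : `|v i 0| <= norm2 v.
Proof.
rewrite -sqrtr_sqr ler_wsqrtr // (bigD1 i) //= lerDl sumr_ge0 // => j _.
exact: sqr_ge0.
Qed.

Lemma mx_norm_le_norm2 n (v : 'cV[R]_n) : `|v| <= norm2 v.
Proof.
apply: mx_norm_le => [|i j]; first exact: norm2_ge0.
by rewrite (ord1 j) ler_norm2_entry.
Qed.

Lemma norm2_le_mx_norm n (v : 'cV[R]_n) : norm2 v <= Num.sqrt n%:R * `|v|.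
Proof.
rewrite -[`|v| in leRHS]ger0_norm // -sqrtr_sqr -sqrtrM //.
rewrite ler_wsqrtr // natr_mul_sum ler_sum // => i _.
by rewrite -[leLHS]real_normK ?num_real // lerXn2r ?nnegrE // ler_mx_entry.
Qed.

Lemma norm2_eq0 n (v : 'cV[R]_n) : norm2 v = 0 -> v = 0.
Proof.
move=> v0; apply/eqP; rewrite -normr_eq0 eq_le normr_ge0 andbT -v0.
exact: mx_norm_le_norm2.
Qed.

Lemma cauchy_schwarz n (u v : 'cV[R]_n) :
  \sum_i u i 0 * v i 0 <= norm2 u * norm2 v.
Proof.
have [u0|u0] := eqVneq (norm2 u) 0.
  rewrite u0 mul0r big1 // => i _.
  by rewrite (norm2_eq0 u0) mxE mul0r.
have [v0|v0] := eqVneq (norm2 v) 0.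
  rewrite v0 mulr0 big1 // => i _.
  by rewrite (norm2_eq0 v0) mxE mulr0.
have ugt0 : 0 < norm2 u by rewrite lt_neqAle eq_sym u0 norm2_ge0.
have vgt0 : 0 < norm2 v by rewrite lt_neqAle eq_sym v0 norm2_ge0.
(* Expand the squared norm of [norm2 v *: u - norm2 u *: v]. *)
have : 0 <= \sum_i (norm2 v * u i 0 - norm2 u * v i 0) ^+ 2.
  by rewrite sumr_ge0 // => i _; rewrite sqr_ge0.
have -> : \sum_i (norm2 v * u i 0 - norm2 u * v i 0) ^+ 2 =
    2 * (norm2 u * norm2 v) * (norm2 u * norm2 v - \sum_i u i 0 * v i 0).
  transitivity (norm2 v ^+ 2 * \sum_i u i 0 ^+ 2
      + norm2 u ^+ 2 * \sum_i v i 0 ^+ 2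
      - 2 * (norm2 u * norm2 v) * \sum_i u i 0 * v i 0).
    rewrite !mulr_sumr -sumrN -!big_split /=; apply: eq_bigr => i _; ring.
  by rewrite -!norm2_sqr; ring.
by rewrite pmulr_rge0 ?subr_ge0 // mulr_gt0 // mulr_gt0.
Qed.

Lemma norm2D n (u v : 'cV[R]_n) : norm2 (u + v) <= norm2 u + norm2 v.
Proof.
rewrite -(@ler_pXn2r _ 2) ?nnegrE ?addr_ge0 ?norm2_ge0 //.
rewrite sqrrD norm2_sqr.
have -> : \sum_i (u + v) i 0 ^+ 2 =
    \sum_i u i 0 ^+ 2 + (\sum_i u i 0 * v i 0) *+ 2 + \sum_i v i 0 ^+ 2.
  rewrite -sumrMnl -!big_split /=; apply: eq_bigr => i _.
  by rewrite mxE sqrrD.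
by rewrite -!norm2_sqr lerD2r lerD2l lerMn2r cauchy_schwarz orbT.
Qed.

Lemma norm2_dist n (u v : 'cV[R]_n) : `|norm2 u - norm2 v| <= norm2 (u - v).
Proof.
rewrite ler_norml lerBlDr lerNl opprB lerBlDr; apply/andP; split.
  have := norm2D (v - u) u; rewrite subrK.
  by rewrite -[v - u]opprB -scaleN1r norm2Z normrN1 mul1r.
by have := norm2D (u - v) v; rewrite subrK.
Qed.

Lemma continuous_norm2_mulmx l k (A : 'M[R]_(l, k)) :
  continuous (fun t : 'rV[R]_k => norm2 (A *m t^T)).
Proof.
move=> t; apply/(cvgrPdist_le (FF := nbhs_filter t)) => e e0.
pose K := Num.sqrt l%:R * (k%:R * `|A|) + 1.
have K0 : 0 < K by rewrite ltr_wpDl // !mulr_ge0 // sqrtr_ge0.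
have eK0 : 0 < e / K by rewrite divr_gt0.
have small : \forall u \near t, `|t - u| <= e / K.
  by apply/nbhs_normP; exists (e / K) => //= u; exact: ltW.
near=> u; apply: le_trans (norm2_dist _ _) _.
rewrite -mulmxBr -linearB /=; apply: le_trans (norm2_le_mx_norm _) _.
apply: (@le_trans _ _ (K * `|t - u|)).
  rewrite mulrDl ler_wpDr ?mul1r // -!mulrA ler_wpM2l ?sqrtr_ge0 //.
  apply: le_trans (mx_norm_mulmx _ _) _.
  by rewrite ler_wpM2l // ler_wpM2l // mx_norm_tr.
by rewrite mulrC -ler_pdivlMr //; near: u.
Unshelve. all: by end_near. Qed.

(** The maximum exists by compactness of the unit sphere. The dimension is a
    successor because the sphere of the zero space is empty. *)
Lemma norm2_mulmx_max l k (A : 'M[R]_(l, k.+1)) :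
  exists2 c : 'cV[R]_k.+1, norm2 c = 1 &
    forall u, norm2 (A *m u) <= norm2 (A *m c) * norm2 u.
Proof.
pose S := [set t : 'rV[R]_k.+1 | norm2 (1%:M *m t^T) = 1].
have ES t : S t = (norm2 t^T = 1) by rewrite /S /= mul1mx.
have cS : compact S.
  apply: bounded_closed_compact.
    exists 1; split => // M M1 t; rewrite ES => t1.
    apply: le_trans (ltW M1); rewrite -t1.
    by apply: le_trans (mx_norm_le_norm2 _); rewrite -{1}[t]trmxK mx_norm_tr.
  apply: (@preimage_closed _ _ _ [set 1 : R]); last exact: closed_eq.
  move=> t _; exact: continuous_norm2_mulmx.
have S0 : S !=set0.
  exists (delta_mx 0 0); rewrite ES trmx_delta /norm2 (bigD1 0) //= mxE eqxx.
  rewrite expr1n big1 ?addr0 ?sqrtr1 // => i /negPf i0.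
  by rewrite mxE i0 expr0n.
have [|c /set_mem Sc cmax] := EVT_max_rV S0 cS (f := fun t => norm2 (A *m t^T)).
  by apply: continuous_subspaceT => t; exact: continuous_norm2_mulmx.
exists c^T; first by rewrite ES in Sc.
move=> u; have [u0|u0] := eqVneq (norm2 u) 0.
  by rewrite u0 (norm2_eq0 u0) mulmx0 norm20 mulr0.
have ugt0 : 0 < norm2 u by rewrite lt_neqAle eq_sym u0 norm2_ge0.
have := cmax ((norm2 u)^-1 *: u)^T.
rewrite trmxK -scalemxAr norm2Z gtr0_norm ?invr_gt0 // mulrC ler_pdivrMr //.
apply; apply/mem_set; rewrite ES trmxK norm2Z gtr0_norm ?invr_gt0 //.
by rewrite mulVf.
Qed.

(** A maximizer [c] is an eigenvector of [A^T *m A]: with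
    [S := t%:M - A^T *m A] positive semidefinite and vanishing at [c] as a
    quadratic form, its first variation at [c] in the direction [S *m c] is
    zero. *)
Lemma norm2_mulmx_max_eigen l k (A : 'M[R]_(l, k)) (c : 'cV[R]_k) :
    norm2 c = 1 ->
    (forall u, norm2 (A *m u) <= norm2 (A *m c) * norm2 u) ->
  c^T *m (A^T *m A) = norm2 (A *m c) ^+ 2 *: c^T.
Proof.
move=> c1 cmax; set t := norm2 (A *m c) ^+ 2.
pose S := t%:M - A^T *m A.
have trS : S^T = S by rewrite /S linearB /= tr_scalar_mx trmx_mul trmxK.
pose q (u : 'cV[R]_k) := (u^T *m S *m u) 0 0.
have qE u : q u = t * norm2 u ^+ 2 - norm2 (A *m u) ^+ 2.
  rewrite !norm2_sqr_mx /q mulmxBr mulmxBl mul_mx_scalar -scalemxAl.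
  by rewrite trmx_mul !mulmxA mxE [in LHS]mxE [X in _ + X]mxE.
have q_ge0 u : 0 <= q u.
  by rewrite qE subr_ge0 -exprMn lerXn2r ?nnegrE ?mulr_ge0 ?norm2_ge0.
have ES : S = t%:M - A^T *m A by [].
(* Otherwise the distributivity rules below would also expand [S]. *)
clearbody S.
have qc : q c = 0 by rewrite qE c1 expr1n mulr1 subrr.
pose w := S *m c.
have qcw h : q (c + h *: w) = 2 * h * norm2 w ^+ 2 + h ^+ 2 * q w.
  have wSc : (w^T *m S *m c) 0 0 = norm2 w ^+ 2.
    by rewrite norm2_sqr_mx -mulmxA.
  have cSw : (c^T *m S *m w) 0 0 = norm2 w ^+ 2.
    by rewrite norm2_sqr_mx /w trmx_mul trS.
  have cSc : (c^T *m S *m c) 0 0 = 0 := qc.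
  have tr : (c + h *: w)^T = c^T + h *: w^T by rewrite linearD linearZ.
  rewrite /q tr !mulmxDl !mulmxDr -!scalemxAl -!scalemxAr.
  move: wSc cSw cSc.
  move: (w^T *m S *m c) (c^T *m S *m w) (c^T *m S *m c) (w^T *m S *m w).
  by move=> X Y Z U; rewrite !mxE => -> -> ->; ring.
have w0 : norm2 w = 0.
  pose Q := q w + 1.
  have Q0 : 0 < Q by rewrite ltr_wpDl.
  (* [Q] is positive even when [q w = 0], and dividing by it makes the step
     short enough for the linear term of [qcw] to dominate. *)
  have := q_ge0 (c + (- norm2 w ^+ 2 / Q) *: w); rewrite qcw.
  have -> : 2 * (- norm2 w ^+ 2 / Q) * norm2 w ^+ 2
      + (- norm2 w ^+ 2 / Q) ^+ 2 * q w =
      - (norm2 w ^+ 4 * (q w + 2) / Q ^+ 2).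
    by rewrite /Q; field; rewrite -/Q gt_eqF.
  rewrite oppr_ge0 => le0; apply/eqP.
  have : norm2 w ^+ 4 * (q w + 2) / Q ^+ 2 == 0.
    rewrite eq_le le0 /= divr_ge0 ?mulr_ge0 ?exprn_ge0 ?norm2_ge0 ?addr_ge0 //.
  have q2 : q w + 2 != 0 by rewrite gt_eqF // ltr_wpDl.
  rewrite !mulf_eq0 invr_eq0 !expf_eq0 /= (gt_eqF Q0) (negPf q2) !orbF.
  by rewrite !orbb.
have : S *m c = 0 := norm2_eq0 w0.
move/(congr1 trmx); rewrite trmx_mul trS trmx0 ES mulmxBr mul_mx_scalar.
by move/eqP; rewrite subr_eq0 => /eqP.
Qed.

(** The spectral norm is the attained operator norm for [norm2]. *)
Lemma spectral_normP l k (A : 'M[R]_(l, k)) : (0 < k)%N ->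
  (forall u, norm2 (A *m u) <= spectral_norm A * norm2 u) /\
  exists2 c, norm2 c = 1 & norm2 (A *m c) = spectral_norm A.
Proof.
case: k A => // k A _; have [c c1 cmax] := norm2_mulmx_max A.
have cE := norm2_mulmx_max_eigen c1 cmax.
suff -> : spectral_norm A = norm2 (A *m c) by split => //; exists c.
rewrite /spectral_norm -[RHS]ger0_norm ?norm2_ge0 // -sqrtr_sqr.
set E := [set _ | _]; congr Num.sqrt; set t := norm2 _ ^+ 2.
(* [t] is the largest eigenvalue: it belongs to [E] and bounds it. *)
have Et : E t.
  apply/eigenvalueP; exists c^T => //; apply: contraTneq isT => c0.
  move: c1; rewrite -[c]trmxK c0 trmx0 norm20.
  by move/eqP; rewrite eq_sym oner_eq0.
have ubE : ubound E t.
  move=> s /eigenvalueP[v vs v0].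
  have := cmax v^T; rewrite -(@ler_pXn2r _ 2) ?nnegrE ?mulr_ge0 ?norm2_ge0 //.
  rewrite exprMn -/t norm2_sqr_mx trmx_mul trmxK !mulmxA -(mulmxA v) vs.
  rewrite -scalemxAl mxE -{1}[v in v *m _]trmxK -norm2_sqr_mx.
  rewrite ler_pM2r // exprn_gt0 // lt_neqAle norm2_ge0 andbT eq_sym.
  apply: contra v0 => /eqP/norm2_eq0/(congr1 trmx); rewrite trmxK trmx0.
  by move=> ->.
apply/eqP; rewrite eq_le; apply/andP; split.
  by apply: ge_sup => //; exists t.
by apply: ub_le_sup => //; exists t.
Qed.

End Norm2.

Lemma trmxD (R : realType) (m n : nat) (A B : 'M[R]_(m, n)) :
  (A + B)^T = A^T + B^T.
Proof. by apply/matrixP => i j; rewrite !mxE. Qed.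

Lemma trmxB (R : realType) (m n : nat) (A B : 'M[R]_(m, n)) :
  (A - B)^T = A^T - B^T.
Proof. by apply/matrixP => i j; rewrite !mxE. Qed.

(** * First-order expansion of the Tikhonov solution *)

Lemma tik_normal_unitmx (R : realType) (m n p : nat) (lam : R)
    (L : 'M[R]_(p, n)) (V : 'M[R]_(m, n)) :
    0 < lam -> \rank (col_mx V L) = n ->
  V^T *m V + lam ^+ 2 *: (L^T *m L) \in unitmx.
Proof.
move=> lam0 rkVL; rewrite -row_free_unit; apply: inj_row_free => v vH.
have : norm2 (V *m v^T) ^+ 2 + lam ^+ 2 * norm2 (L *m v^T) ^+ 2 = 0.
  rewrite !norm2_sqr_mx !trmx_mul !trmxK !mulmxA.
  have /matrixP/(_ 0 0) := congr1 (mulmx^~ v^T) vH.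
  rewrite mul0mx mulmxDr mulmxDl -scalemxAr -scalemxAl !mulmxA.
  move: (v *m V^T *m V *m v^T) (v *m L^T *m L *m v^T) => S T.
  by rewrite !mxE.
move/eqP; rewrite -exprMn paddr_eq0 ?sqr_ge0 // !sqrf_eq0 mulf_eq0.
rewrite (gt_eqF lam0) /= => /andP[/eqP/norm2_eq0 Vv /eqP/norm2_eq0 Lv].
have free : row_free (col_mx V L)^T by rewrite /row_free mxrank_tr rkVL.
apply: (row_free_inj free).
by rewrite -[v]trmxK -trmx_mul mul_col_mx Vv Lv col_mx0 trmx0 mul0mx.
Qed.

(** If [H + E] kills [u], then [u = - invmx H *m E *m u] has at most half its
    own norm. *)
Lemma unitmx_perturb (R : realType) (n : nat) (H E : 'M[R]_n) :
    H \in unitmx -> n%:R * `|invmx H *m E| <= 2^-1 -> H + E \in unitmx.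
Proof.
move=> uH leE; rewrite -unitmx_tr -row_free_unit; apply: inj_row_free => v vHE.
have Ev : v^T = - (invmx H *m E *m v^T).
  have : (H + E) *m v^T = 0.
    by rewrite -[H + E]trmxK -trmx_mul vHE trmx0.
  move/(congr1 (mulmx (invmx H))); rewrite mulmx0 mulmxDl mulmxDr.
  by rewrite mulKmx // mulmxA => /eqP; rewrite addr_eq0 => /eqP.
have : `|v^T| <= 2^-1 * `|v^T|.
  rewrite {1}Ev normrN; apply: le_trans (mx_norm_mulmx _ _) _.
  by rewrite mulrA ler_wpM2r.
have := normr_ge0 v^T => v0 lev; have : `|v^T| = 0 by lra.
by move/eqP; rewrite normr_eq0 => /eqP/(congr1 trmx); rewrite trmxK trmx0.
Qed.

(** The difference of the normal equations satisfied by the perturbed and the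
    unperturbed solutions. *)
Lemma tik_sol_difference (R : realType) (m n p : nat) (lam : R)
    (L : 'M[R]_(p, n)) (V V' : 'M[R]_(m, n)) (b b' : 'cV[R]_m) :
    let H := V^T *m V + lam ^+ 2 *: (L^T *m L) in
    let H' := V'^T *m V' + lam ^+ 2 *: (L^T *m L) in
    let x := tik_sol lam L V b in
    let dx := tik_sol lam L V' b' - x in
    H \in unitmx -> H' \in unitmx ->
  dx = invmx H *m ((V' - V)^T *m (b - V *m x)
                   + V'^T *m (b' - b - (V' - V) *m x))
       - invmx H *m (V'^T *m V' - V^T *m V) *m dx.
Proof.
move=> H H' x dx uH uH'.
have Hx : H *m x = V^T *m b by rewrite /x /tik_sol -mulmxA mulKVmx.
have Hx' : H' *m tik_sol lam L V' b' = V'^T *m b'.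
  by rewrite /tik_sol -mulmxA mulKVmx.
rewrite -[LHS](mulKmx uH) -mulmxA -mulmxBr; congr (_ *m _).
apply: (@addIr _ ((V'^T *m V' - V^T *m V) *m dx)); rewrite subrK -mulmxDl.
have -> : H + (V'^T *m V' - V^T *m V) = H'.
  by rewrite addrC addrA subrK.
rewrite mulmxBr Hx'.
have -> : H' *m x = V'^T *m V' *m x + (V^T *m b - V^T *m V *m x).
  by rewrite -Hx !mulmxDl addrAC subrr add0r.
rewrite trmxB !(mulmxDl, mulmxDr, mulNmx, mulmxN) !mulmxA.
move: (V'^T *m b') (V'^T *m V' *m x) (V^T *m b) (V^T *m V *m x).
move: (V'^T *m b) (V'^T *m V *m x) => z1 z2 z3 z4 z5 z6.
by apply/matrixP => i j; rewrite !mxE; ring.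
Qed.

(** Only the first-order part [D] of the perturbation [dV] of [V] enters the
    linear part of the change of the solution. *)
Lemma tik_sol_expansion (R : realType) (X : normedModType R) (m n p : nat)
    (lam : R) (L : 'M[R]_(p, n)) (V : 'M[R]_(m, n)) (b : 'cV[R]_m)
    (dV D : X -> 'M[R]_(m, n)) (db : X -> 'cV[R]_m) :
    let x := tik_sol lam L V b in
    V^T *m V + lam ^+ 2 *: (L^T *m L) \in unitmx ->
    vanishes 1 D -> vanishes 2 (fun d => dV d - D d) -> vanishes 1 db ->
  exists2 delta : R, 0 < delta & exists C : R, forall d, `|d| <= delta ->
    `|tik_sol lam L (V + dV d) (b + db d) - x
      - tikP lam L V *m ((D d)^T *m (b - V *m x) + V^T *m (db d - D d *m x))|
    <= C * `|d| ^+ 2.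
Proof.
move=> x uH D1 dVD2 db1; rewrite /tikP; set H := _ + _ in uH *.
set r := b - V *m x.
have dV1 : vanishes 1 dV.
  have -> : dV = (fun d => (dV d - D d) + D d).
    by apply/funext => d; rewrite subrK.
  by apply: vanishesD => //; apply: vanishes_le dVD2.
have cst k q (A : 'M[R]_(k, q)) : vanishes 0 (fun _ : X => A).
  exact: vanishes_cst.
pose E d := (V + dV d)^T *m (V + dV d) - V^T *m V.
pose Q d := (dV d)^T *m r + (V + dV d)^T *m (db d - dV d *m x).
pose q d := (D d)^T *m r + V^T *m (db d - D d *m x).
have VdV : vanishes 0 (fun d => (V + dV d)^T).
  apply: vanishes_tr; apply: vanishesD => //; exact: vanishes_le dV1.
have dbV : vanishes 1 (fun d => db d - dV d *m x).
  apply: vanishesB => //; exact: (vanishes_mulmx dV1).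
have PE1 : vanishes 1 (fun d => invmx H *m E d).
  apply: (@vanishes_mulmx _ _ _ _ _ 0 1) => //.
  have -> : E = fun d => V^T *m dV d + (dV d)^T *m (V + dV d).
    apply/funext => d; rewrite /E trmxD mulmxDl !mulmxDr.
    by rewrite addrAC; congr (_ + _); rewrite addrAC subrr add0r.
  apply: vanishesD; first exact: (@vanishes_mulmx _ _ _ _ _ 0 1).
  apply: (@vanishes_mulmx _ _ _ _ _ 1 0); first exact: vanishes_tr.
  by apply: vanishesD => //; exact: vanishes_le dV1.
have PQ1 : vanishes 1 (fun d => invmx H *m Q d).
  apply: (@vanishes_mulmx _ _ _ _ _ 0 1) => //; apply: vanishesD.
    by apply: (@vanishes_mulmx _ _ _ _ _ 1 0) => //; exact: vanishes_tr.
  exact: (vanishes_mulmx VdV).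
have PQq2 : vanishes 2 (fun d => invmx H *m (Q d - q d)).
  apply: (@vanishes_mulmx _ _ _ _ _ 0 2) => //.
  have -> : (fun d => Q d - q d) = fun d => (dV d - D d)^T *m r
      + (dV d)^T *m (db d - dV d *m x) - V^T *m ((dV d - D d) *m x).
    apply/funext => d; rewrite /Q /q trmxB trmxD.
    rewrite !(mulmxDl, mulmxDr, mulNmx, mulmxN).
    apply/matrixP => i j;
    move: (V^T *m db d) (V^T *m (dV d *m x)) (V^T *m (D d *m x)).
    move: ((dV d)^T *m (db d)) ((dV d)^T *m (dV d *m x)).
    move: ((dV d)^T *m r) ((D d)^T *m r) => z1 z2 z3 z4 z5 z6 z7.
    by rewrite !mxE; ring.
  apply: vanishesB; [apply: vanishesD|].
  - by apply: (@vanishes_mulmx _ _ _ _ _ 2 0) => //; exact: vanishes_tr.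
  - by apply: (@vanishes_mulmx _ _ _ _ _ 1 1) => //; exact: vanishes_tr.
  - apply: (@vanishes_mulmx _ _ _ _ _ 0 2) => //.
    exact: (@vanishes_mulmx _ _ _ _ _ 2 0).
have [C1 C1_0 leE] := vanishes_nneg PE1.
have [C2 C2_0 leQ] := vanishes_nneg PQ1.
have [C3 C3_0 leQq] := vanishes_nneg PQq2.
(* Below [delta], multiplication by [invmx H *m E d] at most halves the norm:
   the perturbed normal matrix is invertible and [dx] can be absorbed. *)
pose delta := Num.min 1 (2^-1 / (n%:R * C1 + 1)).
have nC1 : 0 < n%:R * C1 + 1 by rewrite ltr_wpDl // mulr_ge0.
exists delta; first by rewrite lt_min ltr01 divr_gt0 // invr_gt0.
exists (C3 + n%:R * C1 * (2 * C2)) => d; rewrite le_min => /andP[d1 d_small].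
have small : n%:R * `|invmx H *m E d| <= n%:R * C1 * `|d|.
  by rewrite -mulrA ler_wpM2l // (le_trans (leE d d1)) // expr1.
have half : n%:R * C1 * `|d| <= 2^-1.
  move: d_small; rewrite ler_pdivlMr //; apply: le_trans.
  by rewrite mulrC ler_wpM2l // lerDl.
have uH' : H + E d \in unitmx.
  by apply: unitmx_perturb => //; exact: le_trans half.
have EH' : (V + dV d)^T *m (V + dV d) + lam ^+ 2 *: (L^T *m L) = H + E d.
  by rewrite [RHS]addrC /E /H addrA subrK.
have /= := @tik_sol_difference _ _ _ _ lam L V (V + dV d) b (b + db d) uH.
rewrite EH' => /(_ uH'); rewrite -/x -/r -/H.
rewrite [V + _]addrC addrK [b + _]addrC addrK -/x.
rewrite [dV d + V]addrC [db d + b]addrC -/(Q d) -/(E d).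
(* Now [Edx : dx = invmx H *m Q d - invmx H *m E d *m dx], where the second
   term is a product of two factors of order one. *)
set dx := tik_sol _ _ _ _ - x => Edx.
have le_dx : `|dx| <= 2 * C2 * `|d|.
  have : `|dx| <= C2 * `|d| + 2^-1 * `|dx|.
    rewrite {1}Edx; apply: le_trans (ler_normB _ _) _; apply: lerD.
      by rewrite -[`|d|]expr1 leQ.
    apply: le_trans (mx_norm_mulmx _ _) _.
    by rewrite mulrA ler_wpM2r // (le_trans small).
  lra.
rewrite -/(q d) {1}Edx addrAC -mulmxBr.
apply: le_trans (ler_normB _ _) _; rewrite mulrDl.
apply: lerD; first exact: leQq.
apply: le_trans (mx_norm_mulmx _ _) _; rewrite mulrA.
apply: (@le_trans _ _ (n%:R * C1 * `|d| * (2 * C2 * `|d|))).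
  by rewrite ler_pM // mulr_ge0.
by rewrite le_eqVlt; apply/orP; left; apply/eqP; ring.
Qed.

(** * Perturbation of Vandermonde matrices *)

Section VandermondePerturbation.
Variables (R : realType) (m n : nat).
Implicit Types (a : 'cV[R]_n) (b : 'cV[R]_m).

Lemma Diag_mulmxC k (u v : 'cV[R]_k) : Diag u *m v = Diag v *m u.
Proof.
by apply/matrixP => i j; rewrite /Diag !mul_diag_mx !mxE (ord1 j) mulrC.
Qed.

Lemma vdmE a i j : vdm m a i j = a j 0 ^+ i.
Proof. by rewrite !mxE. Qed.

(** Row [i] of [vdm1 (vdm m a)] holds the derivatives of the monomial of
    degree [i]; at [i = 0] the factor [i%:R] makes the exponent irrelevant. *)
Lemma vdm1_vdmE a i j : vdm1 (vdm m a) i j = i%:R * a j 0 ^+ i.-1.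
Proof.
rewrite /vdm1 /Diag mul_diag_mx !mxE; case: eqP => [->|/eqP i0].
  by rewrite mulr0 mul0r.
rewrite /=; case: i i0 => -[//|i] /= im _.
by rewrite modnDr modn_small // ltnW.
Qed.

Lemma vanishes_fst : vanishes 1 (fun d : 'cV[R]_n * 'cV[R]_m => d.1).
Proof. by exists 1 => d _; rewrite mul1r expr1 le_max lexx. Qed.

Lemma vanishes_snd : vanishes 1 (fun d : 'cV[R]_n * 'cV[R]_m => d.2).
Proof. by exists 1 => d _; rewrite mul1r expr1 le_max lexx orbT. Qed.

Lemma vanishes_monomial (X : normedModType R) (h : X -> R) (c : R) i :
  vanishes 1 h ->
  vanishes 2 (fun d => (c + h d) ^+ i - c ^+ i - i%:R * c ^+ i.-1 * h d).
Proof.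
move=> h1; elim: i => [|i IHi].
  by exists 0 => d _; rewrite !expr0 subrr !mul0r subrr normr0.
(* The remainder in degree [i.+1] in terms of the one in degree [i]. *)
have -> : (fun d => (c + h d) ^+ i.+1 - c ^+ i.+1 - i.+1%:R * c ^+ i * h d)
    = (fun d => (c + h d) * ((c + h d) ^+ i - c ^+ i - i%:R * c ^+ i.-1 * h d)
                + i%:R * c ^+ i.-1 * (h d * h d)).
  apply/funext => d; rewrite !exprS -natr1.
  case: i {IHi} => [|i]; first by rewrite !expr0; ring.
  by rewrite !exprS; ring.
apply: vanishesD.
  apply: (@vanishesM _ _ 0 2) => //; apply: vanishesD.
    exact: vanishes_cst.
  exact: vanishes_le h1.
apply: (@vanishesM _ _ 0 2); first exact: vanishes_cst.
exact: (@vanishesM _ _ 1 1).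
Qed.

Lemma vanishes_vdm a :
  vanishes 2 (fun d : 'cV[R]_n * 'cV[R]_m =>
    vdm m (a + d.1) - vdm m a - vdm1 (vdm m a) *m Diag d.1).
Proof.
apply: vanishes_entries => i j.
have -> : (fun d : 'cV[R]_n * 'cV[R]_m =>
    (vdm m (a + d.1) - vdm m a - vdm1 (vdm m a) *m Diag d.1) i j) =
    (fun d => (a j 0 + d.1 j 0) ^+ i - a j 0 ^+ i
              - i%:R * a j 0 ^+ i.-1 * d.1 j 0).
  apply/funext => d.
  have subE (A B : 'M[R]_(m, n)) : (A - B) i j = A i j - B i j.
    by rewrite !mxE.
  rewrite !subE !vdmE [(a + _) _ _]mxE.
  have -> : (vdm1 (vdm m a) *m Diag d.1) i j =
      i%:R * a j 0 ^+ i.-1 * d.1 j 0.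
    by rewrite /Diag mul_mx_diag mxE vdm1_vdmE mxE.
  by [].
apply: vanishes_monomial; have [C leC] := vanishes_fst.
by exists C => d d1; apply: le_trans (leC d d1); exact: ler_mx_entry.
Qed.

Lemma vanishes_Diag_fst (A : 'M[R]_(m, n)) :
  vanishes 1 (fun d : 'cV[R]_n * 'cV[R]_m => A *m Diag d.1).
Proof.
apply: (@vanishes_mulmx _ _ _ _ _ 0 1); first exact: vanishes_cst.
apply: vanishes_entries => i j; have [C leC] := vanishes_fst.
exists `|C| => d d1; rewrite !mxE; case: (i == j); last first.
  by rewrite mulr0n normr0 mulr_ge0 ?exprn_ge0.
rewrite mulr1n; apply: le_trans (ler_mx_entry _ _ _) _.
by apply: le_trans (leC d d1) _; rewrite ler_wpM2r ?exprn_ge0 // ler_norm.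
Qed.

(** First-order expansion of [M *m tik_dx]: the two matrices are the partial
    derivatives of the map from [(a, b)] to [M *m x]. *)
Lemma tik_dx_expansion p l lam (L : 'M[R]_(p, n)) (M : 'M[R]_(l, n)) a b :
    0 < lam -> \rank (col_mx (vdm m a) L) = n ->
    let V := vdm m a in
    let V1 := vdm1 V in
    let P := tikP lam L V in
    let x := tik_sol lam L V b in
    let y := V1^T *m (b - V *m x) in
  exists2 delta : R, 0 < delta & exists C : R,
    forall d : 'cV[R]_n * 'cV[R]_m, `|d| <= delta ->
    `|M *m tik_dx lam L a b d.1 d.2
      - (M *m P *m (Diag y - V^T *m V1 *m Diag x) *m d.1
         + M *m P *m V^T *m d.2)| <= C * `|d| ^+ 2.
Proof.
move=> lam0 rkVL V V1 P x y.
have uH := tik_normal_unitmx lam0 rkVL.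
have [delta delta0 [C leC]] := @tik_sol_expansion _ _ _ _ _ lam L _ b _ _ _ uH
  (vanishes_Diag_fst (vdm1 (vdm m a))) (vanishes_vdm a) vanishes_snd.
exists delta => //; exists (n%:R * (`|M| * C)) => d d_delta.
set G := M *m P *m _; set K := M *m P *m _.
have -> : M *m tik_dx lam L a b d.1 d.2 - (G *m d.1 + K *m d.2) =
    M *m (tik_dx lam L a b d.1 d.2
          - P *m ((V1 *m Diag d.1)^T *m (b - V *m x)
                  + V^T *m (d.2 - V1 *m Diag d.1 *m x))).
  move: (tik_dx lam L a b d.1 d.2) => t; rewrite mulmxBr; congr (_ - _).
  have -> : (V1 *m Diag d.1)^T *m (b - V *m x) = Diag y *m d.1.
    by rewrite trmx_mul -mulmxA tr_diag_mx (Diag_mulmxC d.1).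
  have -> : V1 *m Diag d.1 *m x = V1 *m Diag x *m d.1.
    by rewrite -!mulmxA (Diag_mulmxC d.1 x).
  rewrite /G /K -!mulmxA -!mulmxDr; congr (_ *m (_ *m _)).
  rewrite mulmxDl mulNmx mulmxBr !mulmxA -!addrA; congr (_ + _).
  exact: addrC.
apply: le_trans (mx_norm_mulmx _ _) _; rewrite -!mulrA ler_wpM2l //.
by rewrite ler_wpM2l //; exact: leC.
Qed.

End VandermondePerturbation.

(** * Maximizing the linearization over the two balls *)

Section Balls.
Variables (R : realType) (m n l : nat).
Implicit Types (a : 'cV[R]_n) (b : 'cV[R]_m) (z : 'cV[R]_l).

Lemma divvE z (u : 'cV[R]_l) i : divv u z i 0 = u i 0 / z i 0.
Proof. by rewrite mxE. Qed.

Lemma ler_divv_entry z (u : 'cV[R]_l) i :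
  `|u i 0| / `|z i 0| <= norm_inf (divv u z).
Proof. by rewrite -normfV -normrM -divvE ler_mx_entry. Qed.

Lemma componentwise_ballZ a b e d : 0 < e ->
  componentwise_ball a b e (e *: d) <-> componentwise_ball a b 1 d.
Proof.
move=> e0; have levZ k (u v : 'cV[R]_k) :
    lev (absmx (e *: u)) (e *: absmx v) <-> lev (absmx u) (1 *: absmx v).
  by split => uv i; move: (uv i);
    rewrite !mxE normrM gtr0_norm // mul1r ler_pM2l.
by split=> -[? ?]; split; apply/levZ.
Qed.

Lemma componentwise_ball_bounded a b d :
  componentwise_ball a b 1 d -> `|d| <= Num.max `|a| `|b|.
Proof.
have lev_norm k (u v : 'cV[R]_k) : lev (absmx u) (1 *: absmx v) -> `|u| <= `|v|.
  move=> uv; apply: mx_norm_le => // i j; rewrite (ord1 j).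
  by move: (uv i); rewrite !mxE mul1r => /le_trans; apply; exact: ler_mx_entry.
move=> [/lev_norm d1 /lev_norm d2].
by rewrite prod_normE ge_max !le_max d1 d2 orbT.
Qed.

(** Row [i] of the linearization is maximal when the signs of the perturbations
    match those of the entries of row [i] of [G] and [K]. *)
Lemma componentwise_ball_max (G : 'M[R]_(l, n)) (K : 'M[R]_(l, m)) a b z :
    let w := absmx G *m absmx a + absmx K *m absmx b in
    let A (d : 'cV[R]_n * 'cV[R]_m) := G *m d.1 + K *m d.2 in
  (forall d, componentwise_ball a b 1 d ->
     norm_inf (divv (A d) z) <= norm_inf (divv w z)) /\
  exists2 d, componentwise_ball a b 1 d &
    norm_inf (divv (A d) z) = norm_inf (divv w z).
Proof.
move=> w A.
have rowE k (B : 'M[R]_(l, k)) (v : 'cV[R]_k) i :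
    (absmx B *m absmx v) i 0 = \sum_j `|B i j| * `|v j 0|.
  by rewrite mxE; apply: eq_bigr => j _; rewrite !mxE.
have addE (u v : 'cV[R]_l) i : (u + v) i 0 = u i 0 + v i 0 by rewrite mxE.
have w_ge0 i : 0 <= w i 0.
  by rewrite mxE !rowE addr_ge0 // sumr_ge0 // => j _; rewrite mulr_ge0.
have le_row k (B : 'M[R]_(l, k)) (u v : 'cV[R]_k) i :
    lev (absmx u) (1 *: absmx v) -> `|(B *m u) i 0| <= (absmx B *m absmx v) i 0.
  move=> uv; rewrite rowE mxE; apply: le_trans (ler_norm_sum _ _ _) _.
  apply: ler_sum => j _; rewrite normrM ler_wpM2l //.
  by move: (uv j); rewrite !mxE mul1r.
have leA d : componentwise_ball a b 1 d ->
    norm_inf (divv (A d) z) <= norm_inf (divv w z).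
  move=> [d1 d2]; apply: mx_norm_le => [|i j]; first exact: normr_ge0.
  rewrite (ord1 j).
  rewrite divvE normrM normfV; apply: le_trans (ler_divv_entry _ _ i).
  rewrite ler_wpM2r ?invr_ge0 // [leRHS]ger0_norm // /A /w !addE.
  by apply: le_trans (ler_normD _ _) _; apply: lerD; exact: le_row.
split => //.
have lev_sg k (u v : 'cV[R]_k) (B : 'M[R]_(l, k)) i :
    lev (absmx (\col_j (Num.sg (B i j) * `|v j 0|))) (1 *: absmx v).
  move=> j; rewrite !mxE mul1r normrM normr_id normr_sg.
  by case: (B i j != 0); rewrite ?mul1r ?mul0r.
have row_sg k (v : 'cV[R]_k) (B : 'M[R]_(l, k)) i :
    (B *m \col_j (Num.sg (B i j) * `|v j 0|)) i 0 = (absmx B *m absmx v) i 0.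
  rewrite rowE mxE; apply: eq_bigr => j _.
  by rewrite mxE mulrA [B i j * _]mulrC -normrEsg.
(* When the maximum is zero there may be no row to choose. *)
have [w0|w_neq0] := eqVneq (norm_inf (divv w z)) 0.
  exists (0, 0).
    by split=> i; rewrite !mxE normr0 mul1r.
  rewrite w0 /A !mulmx0 addr0; apply/eqP; rewrite normr_eq0.
  by apply/eqP/matrixP => i j; rewrite !mxE mul0r.
have [[i j] /= Ei] := mx_norm_neq0 w_neq0.
exists (\col_j (Num.sg (G i j) * `|a j 0|), \col_j (Num.sg (K i j) * `|b j 0|)).
  by split; exact: lev_sg.
apply/eqP; rewrite eq_le leA /=; last by split; exact: lev_sg.
rewrite /norm_inf [leLHS]Ei (ord1 j) divvE normrM normfV.
apply: le_trans (ler_divv_entry _ _ i); rewrite ler_wpM2r ?invr_ge0 //.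
by rewrite /A /w !addE !row_sg.
Qed.

Lemma normwise_ballZ a b e d : 0 < e ->
  normwise_ball a b e (e *: d) <-> normwise_ball a b 1 d.
Proof.
move=> e0; rewrite /normwise_ball /= -scale_col_mx norm2Z gtr0_norm //.
by rewrite ler_pM2l // mul1r.
Qed.

Lemma normwise_ball_bounded a b d :
  normwise_ball a b 1 d -> `|d| <= norm2 (col_mx a b).
Proof.
rewrite /normwise_ball /= mul1r => /(le_trans _) le_d.
rewrite prod_normE ge_max; apply/andP; split.
  apply: mx_norm_le => [|i j]; first exact: norm2_ge0.
  by rewrite (ord1 j) -(col_mxEu d.1 d.2) le_d // ler_norm2_entry.
apply: mx_norm_le => [|i j]; first exact: norm2_ge0.
by rewrite (ord1 j) -(col_mxEd d.1 d.2) le_d // ler_norm2_entry.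
Qed.

(** The maximizer is a dilated right singular vector of the stacked matrix. *)
Lemma normwise_ball_max (G : 'M[R]_(l, n)) (K : 'M[R]_(l, m)) a b :
    (0 < n)%N ->
    let s := spectral_norm (row_mx G K) * norm2 (col_mx a b) in
    let A (d : 'cV[R]_n * 'cV[R]_m) := G *m d.1 + K *m d.2 in
  (forall d, normwise_ball a b 1 d -> norm2 (A d) <= s) /\
  exists2 d, normwise_ball a b 1 d & norm2 (A d) = s.
Proof.
move=> n0 s A; have nm0 : (0 < n + m)%N by rewrite addn_gt0 n0.
have [le_spec [c c1 spec_c]] := spectral_normP (row_mx G K) nm0.
have AE d : A d = row_mx G K *m col_mx d.1 d.2 by rewrite mul_row_col.
split=> [d|].
  rewrite /normwise_ball /= mul1r AE => le_d; apply: le_trans (le_spec _) _.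
  by rewrite ler_wpM2l // sqrtr_ge0.
pose v := norm2 (col_mx a b) *: c.
exists (usubmx v, dsubmx v).
  rewrite /normwise_ball /= vsubmxK mul1r norm2Z c1 mulr1.
  by rewrite ger0_norm ?norm2_ge0.
rewrite AE vsubmxK /v -scalemxAr norm2Z spec_c mulrC.
by rewrite ger0_norm ?norm2_ge0.
Qed.

End Balls.

(** * The condition numbers *)

(** Both componentwise condition numbers are of this form: [z] is constant for
    the mixed one, and equal to [M *m x] for the componentwise one. *)
Lemma cvg_componentwise_sup (R : realType) (m n p l : nat) (lam : R)
    (L : 'M[R]_(p, n)) (M : 'M[R]_(l, n)) (a : 'cV[R]_n) (b : 'cV[R]_m)
    (z : 'cV[R]_l) :
    0 < lam -> \rank (col_mx (vdm m a) L) = n ->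
    let V := vdm m a in
    let V1 := vdm1 V in
    let P := tikP lam L V in
    let x := tik_sol lam L V b in
    let y := V1^T *m (b - V *m x) in
    let w := absmx (M *m P *m (V^T *m V1 *m Diag x - Diag y)) *m absmx a
             + absmx (M *m P *m V^T) *m absmx b in
  ereal_sup [set (norm_inf (divv (M *m tik_dx lam L a b d.1 d.2) z) / e)%:E
            | d in componentwise_ball a b e] @[e --> 0^'+]
    --> (norm_inf (divv w z))%:E.
Proof.
move=> lam0 rkVL V V1 P x y w.
have [delta delta0 [C leC]] :=
  @tik_dx_expansion R m n p l lam L M a b lam0 rkVL.
set G := M *m _ *m (Diag _ - _) in leC; set K := M *m _ *m _^T in leC.
(* [G] has the opposite sign to the matrix in [w]. *)
have -> : w = absmx G *m absmx a + absmx K *m absmx b.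
  congr (_ *m _ + _); apply/matrixP => i j.
  rewrite [LHS]mxE [RHS]mxE /G -[Diag _ - _]opprB mulmxN [X in _ = `|X|]mxE.
  by rewrite normrN.
have [le_max max_attained] := componentwise_ball_max G K a b z.
apply: (cvg_sup_expansion (rho := Num.max `|a| `|b|)
    (K := `|\col_i (z i 0)^-1|) (N := fun u => norm_inf (divv u z))
    _ _ _ _ _ _ delta0 leC le_max max_attained).
- move=> u v; rewrite /norm_inf; apply: le_trans (ler_normD _ _).
  rewrite le_eqVlt; apply/orP; left; apply/eqP; congr `|_|.
  by apply/matrixP => i j; rewrite !mxE mulrDl.
- move=> e u e0; rewrite /norm_inf -[X in X * _](gtr0_norm e0) -normrZ.
  by congr `|_|; apply/matrixP => i j; rewrite !mxE mulrA.
- move=> u; apply: mx_norm_le => [|i j]; first by rewrite mulr_ge0.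
  rewrite (ord1 j) divvE normrM mulrC ler_pM ?ler_mx_entry //.
  by apply: le_trans (ler_mx_entry _ i 0); rewrite mxE.
- by move=> e d; rewrite -!scalemxAr -scalerDr.
- by move=> e d; exact: componentwise_ballZ.
- by move=> d; exact: componentwise_ball_bounded.
Qed.

Lemma cvg_normwise_sup (R : realType) (m n p l : nat) (lam : R)
    (L : 'M[R]_(p, n)) (M : 'M[R]_(l, n)) (a : 'cV[R]_n) (b : 'cV[R]_m)
    (c : R) :
    0 < lam -> \rank (col_mx (vdm m a) L) = n -> (0 < n)%N -> 0 < c ->
    let V := vdm m a in
    let V1 := vdm1 V in
    let P := tikP lam L V in
    let x := tik_sol lam L V b in
    let y := V1^T *m (b - V *m x) in
  ereal_sup [set (norm2 (M *m tik_dx lam L a b d.1 d.2) / c / e)%:E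
            | d in normwise_ball a b e] @[e --> 0^'+]
    --> (spectral_norm (M *m P *m row_mx (Diag y - V^T *m V1 *m Diag x) V^T)
         * norm2 (col_mx a b) / c)%:E.
Proof.
move=> lam0 rkVL n0 c0 V V1 P x y.
have [delta delta0 [C leC]] :=
  @tik_dx_expansion R m n p l lam L M a b lam0 rkVL.
rewrite mul_mx_row.
set G := M *m _ *m (Diag _ - _) in leC *; set K := M *m _ *m _^T in leC *.
have [le_max [d1 Bd1 max_attained]] := normwise_ball_max G K a b n0.
apply: (cvg_sup_expansion (rho := norm2 (col_mx a b))
    (K := Num.sqrt l%:R / c) (N := fun u => norm2 u / c)
    _ _ _ _ _ _ delta0 leC).
- by move=> u v; rewrite -mulrDl ler_pM2r ?invr_gt0 // norm2D.
- by move=> e u e0; rewrite norm2Z gtr0_norm // mulrA.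
- by move=> u; rewrite mulrAC ler_pM2r ?invr_gt0 // norm2_le_mx_norm.
- by move=> e d; rewrite -!scalemxAr -scalerDr.
- by move=> e d; exact: normwise_ballZ.
- by move=> d; exact: normwise_ball_bounded.
- by move=> d Bd; rewrite ler_pM2r ?invr_gt0 // le_max.
- by exists d1 => //; rewrite max_attained.
Qed.

Lemma cvg_lim_ereal (R : realType) (f : R -> \bar R) (s : \bar R) :
  f e @[e --> 0^'+] --> s ->
  cvg (f e @[e --> 0^'+]) /\ lim (f e @[e --> 0^'+]) = s.
Proof.
move=> fs; split; first by apply/cvg_ex; exists s.
exact: (cvg_lim (@ereal_hausdorff R) fs).
Qed.

Unset Implicit Arguments.

Theorem theorem3 (R : realType) (m n p l : nat) (lam : R)
    (L : 'M[R]_(p, n)) (M : 'M[R]_(l, n)) (a : 'cV[R]_n) (b : 'cV[R]_m)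
    (lam_gt0 : 0 < lam)
    (rankL : \rank L = p) (le_pn : (p <= n)%N) (le_nm : (n <= m)%N)
    (rankVL : \rank (col_mx (vdm m a) L) = n)
    (le_ln : (l <= n)%N)
    (Mx_neq0 : M *m tik_sol lam L (vdm m a) b != 0) :
  let V := vdm m a in
  let V1 := vdm1 V in
  let P := tikP lam L V in
  let x := tik_sol lam L V b in
  let r := b - V *m x in
  let y := V1^T *m r in
  let w := absmx (M *m P *m (V^T *m V1 *m Diag x - Diag y)) *m absmx a
           + absmx (M *m P *m V^T) *m absmx b in
  [/\ cvg (mixed_sup lam L M a b e @[e --> 0^'+]) /\
      mixed_cond lam L M a b = (norm_inf w / norm_inf (M *m x))%:E,
      (forall i, (M *m x) i 0 != 0) ->
      cvg (componentwise_sup lam L M a b e @[e --> 0^'+]) /\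
      componentwise_cond lam L M a b = (norm_inf (divv w (M *m x)))%:E
    & cvg (normwise_sup lam L M a b e @[e --> 0^'+]) /\
      normwise_cond lam L M a b =
        (spectral_norm (M *m P *m row_mx (Diag y - V^T *m V1 *m Diag x) V^T)
         * norm2 (col_mx a b) / norm2 (M *m x))%:E].
Proof.
move=> V V1 P x r y w.
have Minf : 0 < norm_inf (M *m x) by rewrite normr_gt0.
have M2 : 0 < norm2 (M *m x).
  rewrite lt_neqAle norm2_ge0 andbT eq_sym.
  by apply: contra Mx_neq0 => /eqP/norm2_eq0/eqP.
have n0 : (0 < n)%N.
  case: (posnP n) => // n0; move: Mx_neq0.
  have -> : M = 0 by apply/matrixP => i [j jn]; exfalso; rewrite n0 in jn.
  by rewrite mul0mx eqxx.
split.
- apply: cvg_lim_ereal.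
  have divc (u : 'cV[R]_l) :
      norm_inf (divv u (const_mx (norm_inf (M *m x)))) =
      norm_inf u / norm_inf (M *m x).
    rewrite mulrC -[_^-1]gtr0_norm ?invr_gt0 // /norm_inf -normrZ.
    by congr `|_|; apply/matrixP => i j; rewrite !mxE (ord1 j) mulrC.
  rewrite -divc.
  have -> : mixed_sup lam L M a b = fun e => ereal_sup
      [set (norm_inf (divv (M *m tik_dx lam L a b d.1 d.2)
                           (const_mx (norm_inf (M *m x)))) / e)%:E
      | d in componentwise_ball a b e].
    apply/funext => e; congr ereal_sup; apply: eq_imagel => d _.
    by rewrite divc invfM [e^-1 * _]mulrC mulrA.
  exact: cvg_componentwise_sup.
- move=> _; apply: cvg_lim_ereal.
  have -> : componentwise_sup lam L M a b = fun e => ereal_sup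
      [set (norm_inf (divv (M *m tik_dx lam L a b d.1 d.2) (M *m x)) / e)%:E
      | d in componentwise_ball a b e].
    apply/funext => e; congr ereal_sup; apply: eq_imagel => d _.
    by rewrite mulrC.
  exact: cvg_componentwise_sup.
- apply: cvg_lim_ereal.
  have -> : normwise_sup lam L M a b = fun e => ereal_sup
      [set (norm2 (M *m tik_dx lam L a b d.1 d.2) / norm2 (M *m x) / e)%:E
      | d in normwise_ball a b e].
    apply/funext => e; congr ereal_sup; apply: eq_imagel => d _.
    by rewrite invfM [e^-1 * _]mulrC mulrA.
  exact: cvg_normwise_sup.
Qed.
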